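(* Let $\mathscr{Q}$ be a commutative semicartesian quantale with least element $\bot$, let $I$ be a non-empty set and let $(X_i,\delta_i)_{i\in I}$ be a family of $\mathscr{Q}$-sets. Then the coproduct of $(X_i)_{i\in I}$ in the category $\mathscr{Q}\text{-}\mathbf{Set}$ of $\mathscr{Q}$-sets and functional morphisms is the disjoint union $\coprod_{i\in I}|X_i|$ equipped with $$\delta((x,i),(y,j))=\begin{cases}\delta_i(x,y), & i=j,\\ \bot, & i\neq j.\end{cases}$$
   Context: A quantale $\mathscr{Q}=(|\mathscr{Q}|,\leq,\otimes)$ is a complete lattice with an associative binary operation $\otimes$ that distributes over arbitrary suprema (including the empty one) in each variable. It is commutative if $\otimes$ is commutative, and semicartesian if $a\otimes b\leq a\wedge b$ for all $a,b$. A $\mathscr{Q}$-set is a set $X$ (also written $|X|$) with a map $\delta:X\times X\to\mathscr{Q}$ such that for all $x,y,z\in X$: (1) $\delta(x,y)=\delta(y,x)$; (2) $\delta(x,y)\otimes\delta(y,z)\leq\delta(x,z)$; (3) $\delta(x,x)\otimes\delta(x,y)=\delta(x,y)$. The extent of $x$ is $\mathrm{E}x=\delta(x,x)$. A functional morphism $f:X\to Y$ of $\mathscr{Q}$-sets is a function between the underlying sets with $\delta_X(x,x')\leq\delta_Y(f(x),f(x'))$ and $\mathrm{E}f(x)=\mathrm{E}x$ for all $x,x'\in X$. $\mathscr{Q}\text{-}\mathbf{Set}$ is the category of $\mathscr{Q}$-sets and functional morphisms. *)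

(* Defs.v *)
From HB Require Import structures.
From mathcomp Require Import all_boot all_order.
From mathcomp Require Import boolp classical_sets.

Set Implicit Arguments.
Unset Strict Implicit.
Unset Printing Implicit Defensive.

Import Order.TTheory.

Local Open Scope order_scope.

(* [A = set0] is allowed in all the axioms, so that [\bot] is absorbing.
   No unit is required. *)
HB.mixin Record isQuantale (d : Order.disp_t) (Q : Type)
    of Order.TBLattice d Q := {
  supremums_neq0 : forall A : set Q, (supremums A !=set0)%classic;
  tens : Q -> Q -> Q;
  tensA : associative tens;
  tens_supr : forall (a : Q) (A : set Q) (s : Q),
    supremums A s -> supremums [set tens a x | x in A]%classic (tens a s);
  tens_supl : forall (a : Q) (A : set Q) (s : Q),
    supremums A s -> supremums [set tens x a | x in A]%classic (tens s a)
}.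

#[short(type="quantaleType")]
HB.structure Definition Quantale (d : Order.disp_t) :=
  {Q of isQuantale d Q & Order.TBLattice d Q}.

Notation "a ⊗ b" := (tens a b) (at level 40, left associativity).

Definition semicartesian (d : Order.disp_t) (Q : quantaleType d) : Prop :=
  forall a b : Q, a ⊗ b <= (a `&` b)%O.

Record is_qset (d : Order.disp_t) (Q : quantaleType d) (T : Type)
    (delta : T -> T -> Q) : Prop := IsQSet {
  is_qset_sym : forall x y, delta x y = delta y x;
  is_qset_trans : forall x y z, delta x y ⊗ delta y z <= delta x z;
  is_qset_extent : forall x y, delta x x ⊗ delta x y = delta x y
}.

Record qset (d : Order.disp_t) (Q : quantaleType d) := QSet {
  qset_sort :> Type;
  delta : qset_sort -> qset_sort -> Q;
  qsetP : is_qset delta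
}.

Definition extent (d : Order.disp_t) (Q : quantaleType d) (X : qset Q)
  (x : X) : Q := delta x x.

Record is_functional (d : Order.disp_t) (Q : quantaleType d) (X Y : qset Q)
    (f : X -> Y) : Prop := IsFunctional {
  functional_le : forall x x' : X, delta x x' <= delta (f x) (f x');
  functional_extent : forall x : X, extent (f x) = extent x
}.

Record fmorphism (d : Order.disp_t) (Q : quantaleType d) (X Y : qset Q) :=
  FMorphism {
    fmorphism_fun :> X -> Y;
    fmorphismP : is_functional fmorphism_fun
  }.

Record category := Category {
  obj :> Type;
  hom : obj -> obj -> Type;
  idm : forall A : obj, hom A A;
  compm : forall A B C : obj, hom B C -> hom A B -> hom A C;
  compm_idl : forall (A B : obj) (f : hom A B), compm (idm B) f = f;
  compm_idr : forall (A B : obj) (f : hom A B), compm f (idm A) = f;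
  compmA : forall (A B C D : obj) (h : hom C D) (g : hom B C) (f : hom A B),
    compm h (compm g f) = compm (compm h g) f
}.

Definition is_coproduct (C : category) (I : Type) (X : I -> C) (S : C)
    (inj : forall i, hom (X i) S) : Prop :=
  forall (Y : C) (g : forall i, hom (X i) Y),
    exists! h : hom S Y, forall i, compm h (inj i) = g i.

Section QSetCategory.
Variables (d : Order.disp_t) (Q : quantaleType d).

Lemma fmorphism_eq (X Y : qset Q) (f g : fmorphism X Y) :
  (forall x, f x = g x) -> f = g.
Proof.
case: f g => [f fP] [g gP] /= /funext fg; case: _ / fg in gP *.
by rewrite (Prop_irrelevance fP gP).
Qed.

Lemma is_functional_id (X : qset Q) : is_functional (fun x : X => x).
Proof. by []. Qed.

Definition fmorphism_id (X : qset Q) : fmorphism X X :=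
  FMorphism (is_functional_id X).

Lemma is_functional_comp (X Y Z : qset Q)
    (g : fmorphism Y Z) (f : fmorphism X Y) :
  is_functional (fun x => g (f x)).
Proof.
case: g f => [g [gle gE]] [f [fle fE]]; split=> [x x'|x] /=.
  exact: le_trans (fle x x') (gle (f x) (f x')).
by rewrite gE fE.
Qed.

Definition fmorphism_comp (X Y Z : qset Q)
    (g : fmorphism Y Z) (f : fmorphism X Y) : fmorphism X Z :=
  FMorphism (is_functional_comp g f).

Lemma fmorphism_compid (X Y : qset Q) (f : fmorphism X Y) :
  fmorphism_comp (fmorphism_id Y) f = f.
Proof. exact: fmorphism_eq. Qed.

Lemma fmorphism_idcomp (X Y : qset Q) (f : fmorphism X Y) :
  fmorphism_comp f (fmorphism_id X) = f.
Proof. exact: fmorphism_eq. Qed.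

Lemma fmorphism_compA (W X Y Z : qset Q) (h : fmorphism Y Z)
    (g : fmorphism X Y) (f : fmorphism W X) :
  fmorphism_comp h (fmorphism_comp g f) = fmorphism_comp (fmorphism_comp h g) f.
Proof. exact: fmorphism_eq. Qed.

Definition QSetCat : category :=
  Category fmorphism_compid fmorphism_idcomp fmorphism_compA.

End QSetCategory.

(* The disjoint union is [{i : I & X i}]. When the two indices agree, the first
   point is transported along the equality [e] of indices before applying the
   delta of the common component. *)
Definition coprod_delta (d : Order.disp_t) (Q : quantaleType d) (I : Type)
    (X : I -> qset Q) (u v : {i : I & X i}) : Q :=
  match pselect (projT1 u = projT1 v) with
  | left e => delta (eq_rect _ (fun i => X i : Type) (projT2 u) _ e) (projT2 v)
  | right _ => \bot
  end.

(* Main.v *)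
Require Import Defs.
From HB Require Import structures.
From mathcomp Require Import all_boot all_order.
From mathcomp Require Import boolp classical_sets.

Set Implicit Arguments.
Unset Strict Implicit.
Unset Printing Implicit Defensive.

(** The distance on the disjoint union is [delta] inside a component and [\bot]
across components. Since the tensor preserves the empty supremum, [\bot] is
absorbing, so the axioms of a Q-set hold trivially as soon as two of the points
involved lie in different components, and they reduce to the axioms of one
component otherwise ([is_qset_coprod]).

The universal property is that of the disjoint union of sets: the copairing
[(i, x) |-> g i x] is the only function whose restrictions are the [g i]. It is
a functional morphism ([is_functional_copair]) because each [g i] is one and
because, between different components, the distance [\bot] lies below every
element. *)

Import Order.TTheory.

Local Open Scope order_scope.

Section Absorbing.
Variables (d : Order.disp_t) (Q : quantaleType d).

Lemma supremums_set0 : supremums (set0 : set Q) \bot.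
Proof. by split=> // y _; exact: le0x. Qed.

Lemma tens0x (a : Q) : \bot ⊗ a = \bot.
Proof.
have [_ le_ub] := tens_supl a _ _ supremums_set0.
by apply: le_anti; rewrite le0x andbT; apply: le_ub => _ [x []].
Qed.

Lemma tensx0 (a : Q) : a ⊗ \bot = \bot.
Proof.
have [_ le_ub] := tens_supr a _ _ supremums_set0.
by apply: le_anti; rewrite le0x andbT; apply: le_ub => _ [x []].
Qed.

End Absorbing.

Section Coproduct.
Variables (d : Order.disp_t) (Q : quantaleType d) (I : Type) (X : I -> qset Q).

Local Notation inX := (existT (fun i : I => qset_sort (X i))).

Lemma coprod_delta_same (i : I) (x y : X i) :
  coprod_delta (inX i x) (inX i y) = delta x y.
Proof.
rewrite /coprod_delta /=; case: pselect => // e.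
(* [I] is an arbitrary type: proof irrelevance makes the transport trivial. *)
by rewrite (Prop_irrelevance e (erefl i)).
Qed.

Lemma coprod_delta_neq (i j : I) (x : X i) (y : X j) :
  i <> j -> coprod_delta (inX i x) (inX j y) = \bot.
Proof. by rewrite /coprod_delta /=; case: pselect. Qed.

Lemma is_qset_coprod : is_qset (@coprod_delta d Q I X).
Proof.
split=> [[i x] [j y]|[i x] [j y] [k z]|[i x] [j y]].
- have [eij|nij] := pselect (i = j).
    by case: _ / eij in y *; rewrite !coprod_delta_same (is_qset_sym (qsetP _)).
  by rewrite !coprod_delta_neq // => /esym.
- have [eij|nij] := pselect (i = j); last first.
    by rewrite (coprod_delta_neq x y nij) tens0x le0x.
  case: _ / eij in y *; have [eik|nik] := pselect (i = k); last first.
    by rewrite (coprod_delta_neq y z nik) tensx0 le0x.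
  case: _ / eik in z *.
  by rewrite !coprod_delta_same (is_qset_trans (qsetP _)).
- have [eij|nij] := pselect (i = j).
    case: _ / eij in y *.
    by rewrite !coprod_delta_same (is_qset_extent (qsetP _)).
  by rewrite (coprod_delta_neq x y nij) tensx0.
Qed.

(** The disjoint union of the family [X], as a Q-set. *)
Definition coprod : qset Q := QSet is_qset_coprod.

Lemma is_functional_coprod_in (i : I) :
  is_functional (inX i : X i -> coprod).
Proof.
by split=> [x x'|x]; rewrite /extent /= coprod_delta_same.
Qed.

(** The canonical injection of the [i]-th component. *)
Definition coprod_in (i : I) : fmorphism (X i) coprod :=
  FMorphism (is_functional_coprod_in i).

Section Copairing.
Variables (Y : qset Q) (g : forall i, fmorphism (X i) Y).

Lemma is_functional_copair :
  is_functional (fun u : coprod => g _ (projT2 u)).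
Proof.
split=> [[i x] [j y]|[i x]] /=.
  have [eij|nij] := pselect (i = j).
    case: _ / eij in y *.
    by rewrite coprod_delta_same (functional_le (fmorphismP (g i))).
  by rewrite coprod_delta_neq // le0x.
rewrite (functional_extent (fmorphismP (g i))).
by rewrite /extent /= coprod_delta_same.
Qed.

(** The copairing of the family [g], mapping [(i, x)] to [g i x]. *)
Definition copair : fmorphism coprod Y := FMorphism is_functional_copair.

End Copairing.

Lemma is_coproduct_coprod : @is_coproduct (QSetCat Q) I X coprod coprod_in.
Proof.
move=> Y g; exists (copair g); split=> [i|h hg]; first exact: fmorphism_eq.
by apply: fmorphism_eq => -[i x]; rewrite /= -hg.
Qed.

End Coproduct.

Theorem mainTheorem7 (d : Order.disp_t) (Q : quantaleType d)
    (Qcomm : commutative (@tens d Q)) (Qsemi : semicartesian Q)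
    (I : Type) (I_neq0 : inhabited I) (X : I -> qset Q) :
  exists (SP : is_qset (@coprod_delta d Q I X))
         (inj : forall i : I, fmorphism (X i) (QSet SP)),
    (forall (i : I) (x : X i),
       inj i x = existT (fun j : I => qset_sort (X j)) i x) /\
    @is_coproduct (QSetCat Q) I X (QSet SP) inj.
Proof.
exists (is_qset_coprod X), (@coprod_in d Q I X).
by split=> //; exact: is_coproduct_coprod.
Qed.
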